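(* Let $k\geq 2$ and $\beta\in\mathbb Z_{\geq 0}^k$. The assignment $f\mapsto G(f)$ is a bijection from $\mathrm{Rep}_{\mathbb B}(Q,\beta)$ to the set of spanning subgraphs of $G_\beta$, and it restricts to a bijection from the set $\mathcal N_{\mathbb B}(\beta)$ of nilpotent semirepresentations to the set $\mathrm{DAG}(G_\beta)$ of spanning directed acyclic subgraphs of $G_\beta$. Consequently $|\mathcal N_{\mathbb B}(\beta)|=|\mathrm{DAG}(G_\beta)|$.
   Context: Indices are taken modulo $k$. $\mathbb B=\{0,1\}$ is the Boolean semiring, where $1+1=1$. $Q$ is the cyclic quiver $1\to 2\to\cdots\to k\to 1$. Fix free $\mathbb B$-semimodules $M_1,\ldots,M_k$ with $\mathrm{rank}\,M_i=\beta_i$, each with an ordered basis, and set $\mathrm{Rep}_{\mathbb B}(Q,\beta)=\prod_{i=1}^k\mathrm{Hom}_{\mathbb B}(M_i,M_{i+1})$. A semirepresentation $f=(f_1,\ldots,f_k)$ is nilpotent if for each $1\leq i\leq k$ and all sufficiently large $\ell$ the composition $f_{i+\ell-1}\circ\cdots\circ f_i$ is zero. The directed graph $G_\beta$ has vertex set $\coprod_{i=1}^k[\beta_i]$ and edge set $\coprod_{i=1}^k([\beta_i]\times[\beta_{i+1}])$, where $[n]=\{1,\ldots,n\}$ (each vertex of the $i$-th part has an edge directed to each vertex of the $(i+1)$-st part). For $f\in\mathrm{Rep}_{\mathbb B}(Q,\beta)$ let $F^i$ be the matrix of $f_i$ in the chosen ordered bases; $G(f)$ is the spanning subgraph of $G_\beta$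 that contains the edge $(a,b)\in[\beta_i]\times[\beta_{i+1}]$ precisely when $F^i_{b,a}=1$. A spanning subgraph is one having the full vertex set of $G_\beta$ and a subset of its edges; a directed graph is acyclic if it has no closed directed walk of length $\geq 1$. *)

(* Defs.v *)
From HB Require Import structures.
From mathcomp Require Import all_boot all_order all_algebra.
From mathcomp Require Import boolp classical_sets functions cardinality.

Set Implicit Arguments.
Unset Strict Implicit.
Unset Printing Implicit Defensive.

Import GRing.Theory.
Local Open Scope ring_scope.

(* An alias of bool is needed because the canonical ring structure of bool is
   the field with two elements, where 1 + 1 = 0. *)
Definition boolean : Type := bool.

HB.instance Definition _ := Countable.copy boolean bool.
HB.instance Definition _ := Finite.copy boolean bool.
HB.instance Definition _ :=
  GRing.isNmodule.Build boolean orbA orbC orFb.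

Fact boolean_1neq0 : (true : boolean) != 0. Proof. by []. Qed.

HB.instance Definition _ :=
  GRing.Nmodule_isComNzSemiRing.Build boolean
    andbA andbC andTb andb_orl andFb boolean_1neq0.

Record ordered_basis (R : pzSemiRingType) (V : lSemiModType R) (n : nat) :=
  OrderedBasis {
    basis_vec :> 'I_n -> V;
    basis_coordP : forall v : V,
      exists! c : 'I_n -> R, v = \sum_(j < n) c j *: basis_vec j
  }.

Definition coord_in (R : pzSemiRingType) (V : lSemiModType R) (n : nat)
    (e : ordered_basis V n) (v : V) : 'I_n -> R :=
  sval (cid (basis_coordP e v)).

Definition semilinear_mx (R : pzSemiRingType) (U V : lSemiModType R)
    (m n : nat) (e : ordered_basis U m) (e' : ordered_basis V n)
    (f : {linear U -> V}) : 'M[R]_(n, m) :=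
  \matrix_(b < n, a < m) coord_in e' (f (e a)) b.

(* The vertices 1, ..., k of the cyclic quiver are the elements of 'I_k, and
   ordS is the cyclic successor. *)
Definition semirep (k : nat) (M : 'I_k -> lSemiModType boolean) : Type :=
  forall i : 'I_k, {linear M i -> M (ordS i)}.
Arguments semirep {k} M.

Section Nilpotent.
Variables (k : nat) (M : 'I_k -> lSemiModType boolean) (f : semirep M).

(* f_(i + l - 1) \o ... \o f_i, the identity when l = 0. *)
Fixpoint semirep_comp (i : 'I_k) (l : nat) : M i -> M (iter l (@ordS k) i) :=
  match l with
  | 0 => fun x => x
  | l'.+1 => fun x => f (iter l' (@ordS k) i) (semirep_comp l' x)
  end.

Definition nilpotent_semirep : Prop :=
  forall i : 'I_k, exists L : nat, forall l : nat, (L <= l)%N ->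
    forall x : M i, semirep_comp l x = 0.
End Nilpotent.

Record digraph := Digraph {
  vertex : finType;
  edge : finType;
  source : edge -> vertex;
  target : edge -> vertex
}.

(* Having the full vertex set, a spanning subgraph is given by its edges. *)
Definition spanning_subgraph (G : digraph) : Type := {set edge G}.

Section Acyclic.
Variables (G : digraph) (S : spanning_subgraph G).

(* The list p of edges of S is a directed walk from u to v. *)
Fixpoint is_walk (u v : vertex G) (p : seq (edge G)) : Prop :=
  match p with
  | [::] => u = v
  | d :: p' => [/\ d \in (S : {set edge G}), source d = u
                 & is_walk (target d) v p']
  end.

Definition acyclic : Prop :=
  forall (u : vertex G) (p : seq (edge G)),
    (1 <= size p)%N -> ~ is_walk u u p.
End Acyclic.

Definition DAG (G : digraph) : set (spanning_subgraph G) :=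
  [set S | acyclic S]%classic.
Arguments DAG G : clear implicits.

Section CyclicQuiver.
Variables (k : nat) (beta : 'I_k -> nat).

(* The edge (a, b) in [beta_i] x [beta_(i+1)] is Tagged _ (a, b) at tag i. *)
Definition Gbeta_vertex : finType := {i : 'I_k & 'I_(beta i)}.
Definition Gbeta_edge : finType :=
  {i : 'I_k & ('I_(beta i) * 'I_(beta (ordS i)))%type}.

Definition Gbeta : digraph :=
  @Digraph Gbeta_vertex Gbeta_edge
    (fun d => Tagged (fun i => 'I_(beta i)) (tagged d).1)
    (fun d => @Tagged _ (ordS (tag d)) (fun i => 'I_(beta i)) (tagged d).2).

Definition graph_of (M : 'I_k -> lSemiModType boolean)
    (e : forall i, ordered_basis (M i) (beta i)) (f : semirep M) :
    spanning_subgraph Gbeta :=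
  [set d : Gbeta_edge |
    semilinear_mx (e (tag d)) (e (ordS (tag d))) (f (tag d))
      (tagged d).2 (tagged d).1 == 1]%SET.

Definition nilpotent_semireps (M : 'I_k -> lSemiModType boolean) :
    set (semirep M) :=
  [set f | nilpotent_semirep f]%classic.
End CyclicQuiver.
Arguments nilpotent_semireps {k} M.

(* Main.v *)
From HB Require Import structures.
Require Import Defs.
From mathcomp Require Import all_boot all_order all_algebra.
From mathcomp Require Import boolp classical_sets functions cardinality.

(** A semilinear map is determined by its matrix, and every matrix occurs, so
    f |-> G(f) is bijective. Since B has no zero divisors and no cancellation
    in sums, the (b, a) entry of a product of matrices F^(i+l-1) ... F^i is
    nonzero exactly when G(f) has a walk of length l from a to b; there are
    arbitrarily long walks if and only if there is a closed one. *)

Set Implicit Arguments.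
Unset Strict Implicit.
Unset Printing Implicit Defensive.

Import GRing.Theory.
Local Open Scope ring_scope.

Section Coordinates.
Variables (R : pzSemiRingType) (V : lSemiModType R) (n : nat).
Variable e : ordered_basis V n.

Lemma coord_inK (v : V) : \sum_(j < n) coord_in e v j *: e j = v.
Proof. by have [] := svalP (cid (basis_coordP e v)). Qed.

Lemma coord_in_uniq (c : 'I_n -> R) :
  coord_in e (\sum_(j < n) c j *: e j) = c.
Proof. by have [_] := svalP (cid (basis_coordP e (\sum_j c j *: e j))); apply. Qed.

Lemma coord_inD (u v : V) j :
  coord_in e (u + v) j = coord_in e u j + coord_in e v j.
Proof.
rewrite -{1}(coord_inK u) -{1}(coord_inK v) -big_split /=.
by under eq_bigr do rewrite -scalerDl; rewrite coord_in_uniq.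
Qed.

Lemma coord_inZ (a : R) (v : V) j : coord_in e (a *: v) j = a * coord_in e v j.
Proof.
rewrite -{1}(coord_inK v) scaler_sumr.
by under eq_bigr do rewrite scalerA; rewrite coord_in_uniq.
Qed.

Lemma coord_in0 j : coord_in e 0 j = 0.
Proof. by rewrite -(scale0r (0 : V)) coord_inZ mul0r. Qed.

Lemma coord_in_sum (I : Type) (r : seq I) (P : pred I) (F : I -> V) j :
  coord_in e (\sum_(i <- r | P i) F i) j =
  \sum_(i <- r | P i) coord_in e (F i) j.
Proof.
by apply: (big_morph (fun v => coord_in e v j)) => [u v|];
  [exact: coord_inD | exact: coord_in0].
Qed.

Lemma coord_in_basis (a j : 'I_n) : coord_in e (e a) j = (j == a)%:R.
Proof.
rewrite -[X in coord_in _ X](_ : \sum_(i < n) (i == a)%:R *: e i = _).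
  by rewrite coord_in_uniq.
rewrite (bigD1 a) //= eqxx scale1r big1 ?addr0 // => i /negPf->.
by rewrite scale0r.
Qed.

Lemma coord_in_eq0 (v : V) : (forall j, coord_in e v j = 0) -> v = 0.
Proof.
by move=> v0; rewrite -(coord_inK v) big1 // => j _; rewrite v0 scale0r.
Qed.

(** Extension by linearity: the universal property of a free semimodule, through which every matrix
    is realized by a linear map. *)
Definition basis_extend (W : lSemiModType R) (w : 'I_n -> W) (v : V) : W :=
  \sum_(a < n) coord_in e v a *: w a.

Lemma basis_extend_is_semilinear (W : lSemiModType R) (w : 'I_n -> W) :
  semilinear (basis_extend w).
Proof.
split=> [a v|u v]; rewrite /basis_extend.
  by rewrite scaler_sumr; apply: eq_bigr => i _; rewrite coord_inZ scalerA.
by rewrite -big_split; apply: eq_bigr => i _; rewrite coord_inD scalerDl.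
Qed.

HB.instance Definition _ (W : lSemiModType R) (w : 'I_n -> W) :=
  GRing.isSemilinear.Build R V W *:%R (basis_extend w)
    (basis_extend_is_semilinear w).

Lemma basis_extendE (W : lSemiModType R) (w : 'I_n -> W) a :
  basis_extend w (e a) = w a.
Proof.
rewrite /basis_extend (bigD1 a) //= coord_in_basis eqxx scale1r.
by rewrite big1 ?addr0 // => i /negPf ia; rewrite coord_in_basis ia scale0r.
Qed.

End Coordinates.

Section Matrices.
Variables (R : pzSemiRingType) (U V : lSemiModType R) (m n : nat).
Variables (e : ordered_basis U m) (e' : ordered_basis V n).

Lemma coord_in_linear (f : {linear U -> V}) (u : U) (b : 'I_n) :
  coord_in e' (f u) b =
  \sum_(a < m) coord_in e u a * semilinear_mx e e' f b a.
Proof.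
rewrite -{1}(coord_inK e u) linear_sum coord_in_sum.
by apply: eq_bigr => a _; rewrite linearZ coord_inZ mxE.
Qed.

Lemma semilinear_mx_inj : injective (@semilinear_mx R U V m n e e').
Proof.
move=> f g fg.
have {}fg : f =1 g.
  move=> u; rewrite -(coord_inK e' (f u)) -(coord_inK e' (g u)).
  by apply: eq_bigr => b _; rewrite !coord_in_linear fg.
(* Equal underlying functions give equal bundled maps, because the remaining components are proofs
   of propositions. *)
case: f g fg => [f cf] [g cg] /= /funext fg.
case: g / fg cg => cg; congr GRing.Linear.Pack.
case: cf cg => [[cf1] [cf2]] [[cg1] [cg2]].
by rewrite (Prop_irrelevance cf1 cg1) (Prop_irrelevance cf2 cg2).
Qed.

Lemma semilinear_mx_surj (A : 'M[R]_(n, m)) :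
  exists f : {linear U -> V}, semilinear_mx e e' f = A.
Proof.
exists (basis_extend e (fun a => \sum_(b < n) A b a *: e' b)).
by apply/matrixP => b a; rewrite mxE /= basis_extendE coord_in_uniq.
Qed.

End Matrices.

(** Addition in [boolean] is disjunction, so nonzero terms never cancel; over the field with two
    elements this would fail. *)
Lemma boolean_sum_neq0 (I : finType) (F : I -> boolean) :
  (\sum_i F i != 0) = [exists i, F i != 0].
Proof.
have bE (x : boolean) : (x != 0) = x by case: x.
have -> : (\sum_i F i != 0) = [exists i, F i] by rewrite bE; apply: big_orE.
by apply: eq_existsb => i; rewrite bE.
Qed.

Section Walks.
Variables (G : digraph) (S : spanning_subgraph G).

Lemma is_walk_cat (u v : vertex G) (p q : seq (edge G)) :
  is_walk S u v (p ++ q) <->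
  exists2 w, is_walk S u w p & is_walk S w v q.
Proof.
elim: p u => [|d p IHp] u /=.
  by split=> [|[w -> //]]; exists u.
split=> [[dS du /IHp[w pw wq]]|[w [dS du pw] wq]]; first by exists w.
by split=> //; apply/IHp; exists w.
Qed.

(** If the source of [d] were also the source of a later edge [d'], the stretch from [d] up to just
    before [d'] would be a closed walk. *)
Lemma acyclic_walk_uniq (u v : vertex G) (p : seq (edge G)) :
  acyclic S -> is_walk S u v p -> uniq (map (@source G) p).
Proof.
move=> acS; elim: p u => [//|d p IHp] u [dS du dv].
apply/andP; split; last exact: IHp dv.
apply/negP => /mapP[d' d'p dd']; case/splitPr: d'p dv => p1 p2.
case/is_walk_cat=> w p1w [_ d'w _].
by apply: (acS (source d) (d :: p1)) => //; split=> //; rewrite dd' d'w.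
Qed.

Lemma acyclic_walk_size (u v : vertex G) (p : seq (edge G)) :
  acyclic S -> is_walk S u v p -> (size p <= #|vertex G|)%N.
Proof.
move=> acS /(acyclic_walk_uniq acS)/card_uniqP.
by rewrite size_map => <-; apply: max_card.
Qed.

Lemma closed_walk_iter (u : vertex G) (p : seq (edge G)) (n : nat) :
  is_walk S u u p -> is_walk S u u (iter n (cat p) [::]).
Proof. by move=> up; elim: n => //= n IHn; apply/is_walk_cat; exists u. Qed.

End Walks.

Section CyclicQuiverWalks.
Variables (k : nat) (beta : 'I_k -> nat) (M : 'I_k -> lSemiModType boolean).
Variable e : forall i, ordered_basis (M i) (beta i).

(** An entry in [boolean] is determined by whether it equals 1, so the edge set recovers every
    matrix. *)
Lemma graph_of_inj : injective (graph_of e).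
Proof.
move=> f g /setP fg; apply: functional_extensionality_dep => i.
apply: (@semilinear_mx_inj _ _ _ _ _ (e i) (e (ordS i))).
apply/matrixP => b a.
move: (fg (Tagged (fun i => ('I_(beta i) * 'I_(beta (ordS i)))%type) (a, b))).
by rewrite !inE /=; do 2!case: (semilinear_mx _ _ _ _ _).
Qed.

Lemma graph_of_surj (S : spanning_subgraph (Gbeta beta)) :
  exists f : semirep M, graph_of e f = S.
Proof.
pose A i : 'M[boolean]_(beta (ordS i), beta i) := \matrix_(b, a)
  (Tagged (fun i => ('I_(beta i) * 'I_(beta (ordS i)))%type) (a, b)
     \in (S : {set Gbeta_edge beta})).
exists (fun i => sval (cid (semilinear_mx_surj (e i) (e (ordS i)) (A i)))).
apply/setP => -[i [a b]]; rewrite inE /=.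
by case: cid => g /= ->; rewrite mxE; case: (_ \in _).
Qed.

Lemma graph_of_bij : bijective (graph_of e).
Proof.
rewrite -setTT_bijective; split=> // [f g _ _ /graph_of_inj //|S _].
by have [f <-] := graph_of_surj S; exists f.
Qed.

(** Each edge advances the part by one step of the cycle. This supplies the index equalities needed
    to match walk endpoints with the dependent types of compositions. *)
Lemma is_walk_tag (S : spanning_subgraph (Gbeta beta)) u v p :
  is_walk S u v p -> tag v = iter (size p) (@ordS k) (tag u).
Proof.
by elim: p u => [|d p IHp] u /= => [->//|[_ <- /IHp->]]; rewrite -iterS iterSr.
Qed.

Section FixedSemirep.
Variable f : semirep M.

(** The form of linearity that reduces the vanishing of a composition to basis vectors. *)
Lemma semirep_comp_sum (i : 'I_k) (l : nat) (I : finType)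
    (c : I -> boolean) (x : I -> M i) :
  semirep_comp f l (\sum_j c j *: x j) = \sum_j c j *: semirep_comp f l (x j).
Proof.
elim: l => //= l ->; rewrite linear_sum.
by apply: eq_bigr => j _; rewrite linearZ.
Qed.

(** Induction on [l]: the outermost map corresponds to the last edge of the walk, and the summation
    index [c] is the vertex that this edge leaves. *)
Lemma semirep_comp_walk (i : 'I_k) (a : 'I_(beta i)) (l : nat)
    (b : 'I_(beta (iter l (@ordS k) i))) :
  coord_in (e _) (semirep_comp f l (e i a)) b != 0 <->
  exists2 p, size p = l &
    @is_walk (Gbeta beta) (graph_of e f) (Tagged (fun i => 'I_(beta i)) a)
      (Tagged (fun i => 'I_(beta i)) b) p.
Proof.
elim: l b => [|l IHl] b /=.
  rewrite coord_in_basis; split=> [|[p /size0nil-> /= ab]].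
    by case: (eqVneq b a) => // -> _; exists [::].
  have /eqP := esym ab; rewrite eq_Tagged /= => ->; exact: oner_neq0.
rewrite (coord_in_linear (e _)) boolean_sum_neq0; split.
  case/existsP=> c; set x := coord_in _ _ c; set y := semilinear_mx _ _ _ _ _.
  move=> xy; have {xy} [/IHl[p pl wp] y1] : x != 0 /\ y == 1.
    by move: xy; case: x y => -[].
  exists (rcons p (Tagged (fun i => ('I_(beta i) * 'I_(beta (ordS i)))%type)
                     (c, b))); first by rewrite size_rcons pl.
  rewrite -cats1; apply/is_walk_cat; eexists; first exact: wp.
  by split=> //; rewrite inE.
case; case/lastP => // p d; rewrite size_rcons => -[pl].
rewrite -cats1; case/is_walk_cat=> w wp [dG dw db].
(* The tag [j] of the last edge equals [iter l (@ordS k) i] only propositionally; the tag of [w]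
   provides this equation for [subst]. *)
have := is_walk_tag wp; rewrite pl /=; move: dw db dG wp.
case: d => j [c b'] /= <- /= db dG wp jl.
subst j; have /eqP := db; rewrite eq_Tagged /= => /eqP bb'.
subst b'; apply/existsP; exists c.
have : coord_in (e (iter l (@ordS k) i)) (semirep_comp f l (e i a)) c != 0.
  by apply/IHl; exists p.
move: dG; rewrite inE /= => /eqP->.
by rewrite mulr1.
Qed.

Lemma nilpotent_semirepP :
  nilpotent_semirep f <-> acyclic (graph_of e f : spanning_subgraph (Gbeta beta)).
Proof.
split=> [nilf [i a] p p_gt0 wp|acf i].
  have [L fL] := nilf i.
  (* Repeating the nonempty closed walk [L] times gives length at least [L], where the composition
     should vanish. *)
  have sz : size (iter L (cat p) [::]) = (L * size p)%N.
    by elim: L {fL} => //= L IHL; rewrite size_cat IHL mulSn.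
  have := closed_walk_iter L wp; set q := iter L _ _ in sz *; move=> wq.
  (* The walk ends in its initial part, but the target type of the composition is indexed by the
     iterate, so [a] has to be transported along [iq]. *)
  have iq : iter (size q) (@ordS k) i = i by have := is_walk_tag wq.
  have Lq : (L <= size q)%N by rewrite sz leq_pmulr.
  have /semirep_comp_walk/eqP[] :
      exists2 p', size p' = size q & @is_walk (Gbeta beta) (graph_of e f)
        (Tagged (fun i => 'I_(beta i)) a)
        (Tagged (fun i => 'I_(beta i)) (ecast z 'I_(beta z) (esym iq) a)) p'.
    by exists q => //; case: _ / (esym iq).
  by rewrite fL // coord_in0.
(* The sources along a walk in an acyclic graph are distinct, so no walk has more edges than there
   are vertices; one bound serves all [i]. *)
exists #|Gbeta_vertex beta|.+1 => l lL x.
rewrite -(coord_inK (e i) x) semirep_comp_sum big1 // => a _.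
rewrite [semirep_comp _ _ _](@coord_in_eq0 _ _ _ (e _)) ?scaler0 // => b.
apply/eqP; apply: contraTT lL => /semirep_comp_walk[p pl wp].
by rewrite -leqNgt -pl; apply: acyclic_walk_size wp.
Qed.

End FixedSemirep.

Lemma graph_of_nilpotent_bij :
  set_bij (nilpotent_semireps M) (DAG (Gbeta beta)) (graph_of e).
Proof.
split=> [f nf|f g _ _ /graph_of_inj //|S acS]; first exact/nilpotent_semirepP.
have [f fS] := graph_of_surj S; exists f => //.
by apply/nilpotent_semirepP; rewrite fS.
Qed.

End CyclicQuiverWalks.

Theorem mainTheorem7 (k : nat) (beta : 'I_k -> nat)
    (M : 'I_k -> lSemiModType boolean)
    (e : forall i : 'I_k, ordered_basis (M i) (beta i)) (hk : (2 <= k)%N) :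
  [/\ bijective (graph_of e : semirep M -> spanning_subgraph (Gbeta beta)),
      set_bij (nilpotent_semireps M) (DAG (Gbeta beta)) (graph_of e),
      finite_set (nilpotent_semireps M), finite_set (DAG (Gbeta beta))
    & card_eq (nilpotent_semireps M) (DAG (Gbeta beta))].
Proof.
have bijN := graph_of_nilpotent_bij e.
have finD : finite_set (DAG (Gbeta beta)).
  exact: (@finite_finset {set edge (Gbeta beta)}).
have cardN : card_eq (nilpotent_semireps M) (DAG (Gbeta beta)).
  have [fN injN surjN] := bijN.
  (* [inj_card_eq] compares a set with its image, so the target is first rewritten as the image. *)
  have <- : (graph_of e @` nilpotent_semireps M = DAG (Gbeta beta))%classic.
    by apply/seteqP; split=> // _ [f /fN ? <-].
  by rewrite card_eq_sym; apply: inj_card_eq.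
split=> //; first exact: graph_of_bij.
(* Finiteness is immediate only on the graph side, where the edge sets form a finite type; it is
   carried back along the equality of cardinals. *)
by rewrite (eq_finite_set cardN).
Qed.
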